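(* Let $\mathbb{A}$ be a cellular algebra over a field $\mathbb{F}$ with a decomposition $1_{\mathbb{A}}=\sum_{i\in I}e_i$ satisfying (A1)–(A4), and suppose $\Lambda=\Lambda^0$. Two elements $\lambda,\mu\in\Lambda$ lie in the same block of $\mathbb{A}$ if and only if there exist $\nu_0,\dots,\nu_r\in\Lambda$ such that: $\lambda$ and $\nu_0$ lie in the same cell-block of $e_i\mathbb{A}e_i$ for some $i\in I$; for each $j=0,\dots,r-1$, $\nu_j$ and $\nu_{j+1}$ lie in the same cell-block of $e_{i}\mathbb{A}e_{i}$ for some $i\in I$ (depending on $j$); and $\mu$ and $\nu_r$ lie in the same cell-block of $e_i\mathbb{A}e_i$ for some $i\in I$.
   Context: A cellular algebra over a field $\mathbb{F}$ is an associative unital $\mathbb{F}$-algebra $\mathbb{A}$ with a tuple $(\Lambda,T(\cdot),\mathsf{C},* )$ such that: $\Lambda$ is a finite poset; for each $\lambda\in\Lambda$, $T(\lambda)$ is a nonempty finite set and for $s,t\in T(\lambda)$ there is $c^\lambda_{st}\in\mathbb{A}$, with $\mathsf{C}=\{c^\lambda_{st}\}$ an $\mathbb{F}$-basis of $\mathbb{A}$; $*$ is an $\mathbb{F}$-linear anti-automorphism with $*^2=\mathrm{id}$ and $(c^\lambda_{st})^*=c^\lambda_{ts}$; and for $a\in\mathbb{A}$, $a c^\lambda_{st}\equiv\sum_{u\in T(\lambda)}r_a^{(u,s)}c^\lambda_{ut}\mod \mathbb{A}^{>\lambda}$ with $r_a^{(u,s)}\in\mathbb{F}$ depending only on $a,u,s$,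 where $\mathbb{A}^{>\lambda}$ is the span of basis elements $c^\mu_{xy}$ with $\mu>\lambda$. The cell module $\Delta(\lambda)$ has basis $\{c^\lambda_s\}$ and action $a c^\lambda_s=\sum_u r_a^{(u,s)}c^\lambda_u$, bilinear form $\langle c^\lambda_s,c^\lambda_t\rangle c^\lambda_{ub}\equiv c^\lambda_{us}c^\lambda_{tb}\mod\mathbb{A}^{>\lambda}$, radical $\operatorname{Rad}\Delta(\lambda)$; $\Lambda^0=\{\lambda\mid\langle\,,\rangle\ne0\}$ and $L(\lambda)=\Delta(\lambda)/\operatorname{Rad}\Delta(\lambda)$ for $\lambda\in\Lambda^0$ are the simple modules. For $\lambda\in\Lambda,\mu\in\Lambda^0$, $d_{\lambda\mu}=[\Delta(\lambda):L(\mu)]$; $\lambda,\mu$ are cell-linked if $d_{\lambda\mu}\neq0$, and a cell-block is an equivalence class of the equivalence relation on $\Lambda$ generated by cell-linkage. Blocks of $\mathbb{A}$ are labelled by the subsets of $\Lambda^0$ indexing simple modules in the same block. Assumptions: (A1) $I$ finite; (A2) $1_{\mathbb{A}}=\sum_{i\in I}e_i$, $e_i\neq0$, $e_i^2=e_i$, $e_ie_j=0$ for $i\neq j$; (A3) for each $\lambda$ and $t\in T(\lambda)$ there is $i$ with $e_ic^\lambda_{ts}=c^\lambda_{ts}$ for all $s$; (A4) $e_i^*=e_i$. Notation: $T(\lambda,i)=\{t\in T(\lambda)\mid e_ic^\lambda_{ts}=c^\lambda_{ts}\ \forall s\}$, $\Lambda_i=\{\lambda\mid T(\lambda,i)\neq\emptyset\}$.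 $e_i\mathbb{A}e_i$ is a cellular algebra with basis $\{c^\lambda_{st}\mid s,t\in T(\lambda,i),\lambda\in\Lambda_i\}$, poset $\Lambda_i$, and cell modules $V(\lambda,i)=e_i\Delta(\lambda)$; its cell-blocks are subsets of $\Lambda_i$. *)

(* Defs.v *)
From HB Require Import structures.
From mathcomp Require Import all_boot all_order all_algebra all_field.
From Stdlib Require Import ClassicalEpsilon Relations.
Unset Implicit Arguments.
Import GRing.Theory.
Local Open Scope ring_scope.

Section Cellular.
Variables (F : fieldType) (A : falgType F).
Variables (L : finType) (le : rel L) (T : L -> finType).
Variable (c : forall l : L, T l -> T l -> A).
Variable (star : A -> A).
(* structure constants of the cellular multiplication rule:
   r l a u s = r_a^{(u,s)} for the cell indexed by l *)
Variable (r : forall l : L, A -> T l -> T l -> F).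

Definition allidx : forall l : L, pred (T l) := fun l _ => true.

Definition lt_cell (l m : L) : bool := le l m && (l != m).

Definition cell_basis_seq : seq A :=
  flatten (map (fun l => flatten (map (fun s => map (fun t => c l s t) (enum (T l))) (enum (T l)))) (enum L)).

(* A^{> l}, relative to a family of predicates P selecting indices;
   P = predT gives A^{>l}, P = T(.,i) gives (e_i A e_i)^{>l}. *)
Definition Agt (P : forall l, pred (T l)) (l : L) : {vspace A} :=
  <<flatten (map (fun m => flatten (map (fun s => map (fun t => c m s t)
        (filter (P m) (enum (T m)))) (filter (P m) (enum (T m)))))
      (filter (lt_cell l) (enum L)))>>%VS.

Definition is_cellular : Prop :=
  [/\ [/\ (forall l, le l l),
          (forall l m, le l m -> le m l -> l = m) &
          (forall l m k, le l m -> le m k -> le l k)],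
      (forall l, 0 < #|T l|)%N,
      basis_of fullv cell_basis_seq,
      [/\ (forall (k : F) x y, star (k *: x + y) = k *: star x + star y),
          (forall x y, star (x * y) = star y * star x),
          (forall x, star (star x) = x) &
          (forall l s t, star (c l s t) = c l t s)] &
      (forall (a : A) l s t,
         a * c l s t - \sum_(u : T l) r l a u s *: c l u t \in Agt allidx l)].

(* ---------- cell modules, realised inside row vectors 'rV_#|T l| ---------- *)
Definition csize (l : L) : nat := #|T l|.

Definition cvec (l : L) (s : T l) : 'rV[F]_(csize l) := delta_mx 0 (enum_rank s).

(* action of a on Delta(l): a c_s = sum_u r_a^{(u,s)} c_u  (row-vector convention) *)
Definition crho (l : L) (a : A) : 'M[F]_(csize l) :=
  \matrix_(i, j) r l a (enum_val j) (enum_val i).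

Definition Dmod (P : forall l, pred (T l)) (l : L) : 'M[F]_(csize l) :=
  (\sum_(s : T l | P l s) <<cvec l s>>)%MS.

Definition cform_spec (P : forall l, pred (T l)) (l : L) (s t : T l) (k : F) : Prop :=
  forall u b : T l, P l u -> P l b ->
    c l u s * c l t b - k *: c l u b \in Agt P l.

Definition cform (P : forall l, pred (T l)) (l : L) (s t : T l) : F :=
  epsilon (inhabits 0) (cform_spec P l s t).

Definition Gram (P : forall l, pred (T l)) (l : L) : 'M[F]_(csize l) :=
  \matrix_(i, j) (if P l (enum_val i) && P l (enum_val j)
                  then cform P l (enum_val i) (enum_val j) else 0).

Definition in_Lambda0 (P : forall l, pred (T l)) (l : L) : bool := Gram P l != 0.

Definition Radm (P : forall l, pred (T l)) (l : L) : 'M[F]_(csize l) :=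
  (Dmod P l :&: kermx (Gram P l *m (Dmod P l)^T))%MS.

Definition is_submod (S : pred A) (l : L) (U : 'M[F]_(csize l)) : Prop :=
  forall a, S a -> (U *m crho l a <= U)%MS.

(* N2/N1 (N1 <= N2 <= Delta(l)) is isomorphic, as an S-module,
   to L(m) = Dmod P m / Radm P m: there is a linear map f from Dmod P m
   inducing an isomorphism Dmod P m / Radm P m -> N2 / N1. *)
Definition subquo_iso_simple (S : pred A) (P : forall l, pred (T l))
    (m l : L) (N1 N2 : 'M[F]_(csize l)) : Prop :=
  exists f : 'M[F]_(csize m, csize l),
    [/\ (Dmod P m *m f <= N2)%MS,
        (Dmod P m *m f + N1 == N2)%MS,
        ((Dmod P m :&: kermx (f *m cokermx N1)) == Radm P m)%MS &
        (forall a, S a -> (Dmod P m *m (crho m a *m f - f *m crho l a) <= N1)%MS)].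

Definition comp_series (S : pred A) (P : forall l, pred (T l)) (l : L)
    (k : nat) (M : nat -> 'M[F]_(csize l)) : Prop :=
  [/\ (M 0%N == (0 : 'M[F]_(csize l)))%MS,
      (M k == Dmod P l)%MS,
      (forall j, is_submod S l (M j)),
      (forall j, (j < k)%N -> (M j < M j.+1)%MS) &
      (forall j (U : 'M[F]_(csize l)), (j < k)%N -> is_submod S l U ->
          ~ (M j < U < M j.+1)%MS)].

(* d_{l m} = [Delta(l) : L(m)] <> 0 : L(m) occurs as a factor of a
   composition series of Delta(l) (by Jordan-Hoelder, the multiplicity is
   the number of such factors) *)
Definition cell_linked (S : pred A) (P : forall l, pred (T l)) (l m : L) : Prop :=
  in_Lambda0 P m /\
  exists k M j, [/\ comp_series S P l k M, (j < k)%N &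
                    subquo_iso_simple S P m l (M j) (M j.+1)].

Definition in_LambdaP (P : forall l, pred (T l)) (l : L) : bool :=
  [exists s : T l, P l s].

Definition same_cellblock (S : pred A) (P : forall l, pred (T l)) (l m : L) : Prop :=
  [/\ in_LambdaP P l, in_LambdaP P m &
      clos_refl_sym_trans L
        (fun x y => [/\ in_LambdaP P x, in_LambdaP P y & cell_linked S P x y]) l m].

Variables (I : finType) (e : I -> A).

Definition Tidx (i : I) (l : L) : pred (T l) :=
  fun t => [forall s : T l, e i * c l t s == c l t s].

Definition in_eAe (i : I) : pred A := fun a => e i * a * e i == a.

Definition same_cellblock_e (i : I) (l m : L) : Prop :=
  same_cellblock (in_eAe i) (Tidx i) l m.

Definition central (z : A) : Prop := forall a : A, a * z = z * a.
Definition central_idem (z : A) : Prop := [/\ central z, z * z = z & z != 0].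
Definition primitive_central_idem (z : A) : Prop :=
  central_idem z /\
  ~ (exists z1 z2, [/\ central_idem z1, central_idem z2, z1 * z2 = 0 & z = z1 + z2]).

Definition acts_nonzero (z : A) (l : L) : bool :=
  ~~ (Dmod allidx l *m crho l z <= Radm allidx l)%MS.

Definition same_block (l m : L) : Prop :=
  exists z, [/\ primitive_central_idem z, acts_nonzero z l & acts_nonzero z m].

(* assumptions (A1)-(A4); (A1) is built into I : finType *)
Definition idem_decomp : Prop :=
  [/\ \sum_(i : I) e i = 1,
      [/\ (forall i, e i != 0),
          (forall i, e i * e i = e i) &
          (forall i j, i != j -> e i * e j = 0)],
      (forall l (t : T l), exists i, forall s, e i * c l t s = c l t s) &
      (forall i, star (e i) = e i)].

End Cellular.

(* Main.v *)
Require Import Defs.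
From HB Require Import structures.
From mathcomp Require Import all_boot all_order all_algebra all_field.
From Stdlib Require Import ClassicalEpsilon Relations.
Import GRing.Theory.
Local Open Scope ring_scope.

(** A central idempotent [z] acts on every cell module by a scalar, because the
    Gram form is nonzero, and a composition factor [L(m)] of [V(l, i)] forces the
    scalars of [z] at [l] and [m] to agree.  Hence blocks are unions of classes of
    the relation generated by the cell-linkages of the algebras [e_i A e_i].

    Conversely, let [b] be the indicator of such a class.  Some [a] commuting with
    all the [e_i] acts on each [L(m)] as [b m].  Every composition factor of
    [V(l, i)] is some [L_i(m)] with [m] linked to [l], so [a - b l] is nilpotent on
    each cell module; a polynomial in [a] is then an idempotent [h] acting on every
    cell module [Delta(l)] exactly as [b l].  Both [h] and its image under the
    involution do so, so [h x (1 - h)] and [(1 - h) x h] are fixed by a map that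
    strictly raises the cell filtration, hence vanish, and [h] is central. *)

(** Geometric sums for [1 - a ^+ n] and for [a] give the factors. Where [a ^+ n] vanishes so does
    [h], and where [(1 - a) ^+ n] vanishes [h] becomes 1. *)
Lemma idem_poly (R : pzRingType) (a : R) n (h := 1 - (1 - a ^+ n) ^+ n) :
  exists q1 q2, [/\ h = a ^+ n * q1, h = q1 * a ^+ n & 1 - h = (1 - a) ^+ n * q2].
Proof.
pose y := a ^+ n; pose q1 := \sum_(i < n) (1 - y) ^+ i.
have hE : h = y * q1.
  rewrite /h -/y -opprB subrX1 -mulNr opprB; congr (_ * _).
  by rewrite opprD addrA subrr add0r opprK.
have comm_y : GRing.comm y q1.
  apply: commr_sum => i _; apply: commrX; apply: commrB; first exact: commr1.
  exact: commr_refl.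
pose q := \sum_(i < n) a ^+ i.
have comm_q : GRing.comm (1 - a) q.
  apply: commr_sum => i _; apply: commrX; apply: commr_sym; apply: commrB.
    exact: commr1.
  exact: commr_refl.
exists q1, (q ^+ n); split=> //; first by rewrite hE comm_y.
rewrite -exprMn_comm // /h opprB addrC subrK; congr (_ ^+ _).
by rewrite /q -opprB subrX1 -mulNr opprB.
Qed.

Lemma scalar_mx0 (R : pzRingType) n : (0 : R)%:M = 0 :> 'M_n.
Proof. exact: raddf0. Qed.

(** * Coordinates in the cellular basis *)

Section CellularTheory.
Variables (F : fieldType) (A : falgType F) (L : finType) (le : rel L).
Variables (T : L -> finType) (c : forall l : L, T l -> T l -> A).
Variables (star : A -> A) (r : forall l : L, A -> T l -> T l -> F).
Hypothesis cellA : is_cellular F A L le T c star r.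

Local Notation lt := (lt_cell L le).
Local Notation Agt := (Agt F A L le T c).
Local Notation all_idx := (allidx L T).
Local Notation crho := (crho F A L T r).

(** The sigma type of triples [(l, s, t)] turns the nested enumeration of the basis into one tuple,
    to which [coord] applies. *)
Let J : finType := {l : L & (T l * T l)%type}.
Let cJ (j : J) : A := c (tag j) (tagged j).1 (tagged j).2.
Let mkJ (l : L) (s t : T l) : J := Tagged (fun l => (T l * T l)%type) (s, t).
Let X : #|J|.-tuple A := map_tuple cJ (enum_tuple J).

Definition coef (l : L) (s t : T l) (a : A) : F :=
  coord X (enum_rank (mkJ l s t)) a.

Let XE (j : J) : X`_(enum_rank j) = cJ j.
Proof.
rewrite (nth_map j) -?enum_val_nth ?enum_rankK //.
by rewrite -cardE.
Qed.

Let cell_basis_seq_perm : perm_eq (cell_basis_seq F A L T c) X.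
Proof.
pose sJ := [seq (Tagged (fun l => (T l * T l)%type) x : J) | l <- enum L,
             x <- [seq (s, t) | s <- enum (T l), t <- enum (T l)]].
have -> : cell_basis_seq F A L T c = map cJ sJ.
  rewrite /sJ /cell_basis_seq map_flatten -map_comp; congr flatten.
  apply: eq_map => l /=; rewrite -map_comp map_flatten -map_comp; congr flatten.
  by apply: eq_map => s /=; rewrite -map_comp.
apply: perm_map; apply: uniq_perm; last 2 first.
- exact: enum_uniq.
- move=> [l [s t]]; rewrite mem_enum; apply/allpairsPdep.
  by exists l, (s, t); rewrite mem_enum allpairs_f ?mem_enum.
apply: allpairs_uniq_dep; first exact: enum_uniq.
- by move=> l _; apply: allpairs_uniq; rewrite ?enum_uniq // => -[? ?] [].
- by move=> [l x] [m y] _ _.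
Qed.

Let basisX : basis_of fullv X.
Proof. by case: cellA => _ _ + _ _; rewrite (perm_basis _ cell_basis_seq_perm). Qed.

Lemma coef_linear l s t k x y :
  coef l s t (k *: x + y) = k * coef l s t x + coef l s t y.
Proof. by rewrite /coef linearP. Qed.

Lemma coef0 l s t : coef l s t 0 = 0.
Proof. by rewrite /coef linear0. Qed.

Lemma coefZ l s t k x : coef l s t (k *: x) = k * coef l s t x.
Proof. by rewrite /coef linearZ. Qed.

Lemma coefD l s t x y : coef l s t (x + y) = coef l s t x + coef l s t y.
Proof. by rewrite /coef linearD. Qed.

Lemma coefB l s t x y : coef l s t (x - y) = coef l s t x - coef l s t y.
Proof. by rewrite /coef linearB. Qed.

Lemma coef_sum l s t (K : finType) (P : pred K) (x : K -> A) :
  coef l s t (\sum_(k | P k) x k) = \sum_(k | P k) coef l s t (x k).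
Proof. by rewrite /coef linear_sum. Qed.

Let coefJ j k : coord X (enum_rank j) (cJ k) = (j == k)%:R.
Proof.
rewrite -XE coord_free ?(basis_free basisX) //.
by rewrite (inj_eq enum_rank_inj) eq_sym.
Qed.

Lemma coef_c l s t u v : coef l s t (c l u v) = ((s == u) && (t == v))%:R.
Proof.
rewrite /coef (_ : c l u v = cJ (mkJ l u v)) // coefJ /mkJ.
by rewrite -tag_eqE /tag_eq eqxx tagged_asE.
Qed.

Lemma coef_c_neq l m s t u v : l != m -> coef l s t (c m u v) = 0.
Proof.
move=> lm; rewrite /coef (_ : c m u v = cJ (mkJ m u v)) // coefJ /mkJ.
by rewrite -tag_eqE /tag_eq (negPf lm).
Qed.

Lemma cell_expand a :
  a = \sum_l \sum_s \sum_t coef l s t a *: c l s t.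
Proof.
rewrite {1}(coord_basis basisX (memvf a)).
under [RHS]eq_bigr => l _ do rewrite pair_bigA.
rewrite sig_big_dep /= (reindex (@enum_rank J)) /=; last first.
  by exists enum_val => j _; rewrite ?enum_rankK ?enum_valK.
by apply: eq_bigr => -[l [s t]] _; rewrite XE.
Qed.

Lemma coefP x y : (forall l s t, coef l s t x = coef l s t y) -> x = y.
Proof.
move=> xy; rewrite (cell_expand x) (cell_expand y).
by do 3![apply: eq_bigr => ? _]; rewrite xy.
Qed.

(** * The spans of higher cells and the order on cells *)

Lemma Agt_c (P : forall l, pred (T l)) l m s t :
  lt l m -> P m s -> P m t -> c m s t \in Agt P l.
Proof.
move=> lm Ps Pt; apply: memv_span; apply/flatten_mapP; exists m.
  by rewrite mem_filter lm mem_enum.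
apply/flatten_mapP; exists s; first by rewrite mem_filter Ps mem_enum.
by apply/mapP; exists t; rewrite // mem_filter Pt mem_enum.
Qed.

(** The generators are part of a basis, so every congruence modulo higher cells becomes a statement
    about single coordinates. *)
Lemma AgtP (P : forall l, pred (T l)) l a :
  reflect (forall m s t, ~~ [&& lt l m, P m s & P m t] -> coef m s t a = 0)
          (a \in Agt P l).
Proof.
apply: (iffP idP) => [|a0].
  rewrite /Defs.Agt; set Y := flatten _.
  move=> /(coord_span (X := in_tuple Y)) -> m s t.
  move=> notP; rewrite coef_sum big1 // => i _; rewrite coefZ.
  have : Y`_i \in Y by apply: mem_nth.
  case/flatten_mapP=> k; rewrite mem_filter => /andP[lk _].
  case/flatten_mapP=> u; rewrite mem_filter => /andP[Pu _].
  case/mapP=> v; rewrite mem_filter => /andP[Pv _] ->.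
  have [mk|mk] := eqVneq m k; last by rewrite coef_c_neq ?mulr0.
  case: k / mk lk u Pu v Pv => lk u Pu v Pv.
  rewrite coef_c; case: eqP => [su|]; last by rewrite mulr0.
  case: eqP => [tv|]; last by rewrite mulr0.
  by rewrite su tv lk Pu Pv in notP.
rewrite (cell_expand a).
apply: memv_suml => m _; apply: memv_suml => s _; apply: memv_suml => t _.
have [/and3P[lm Ps Pt]|/a0->] := boolP [&& lt l m, P m s & P m t].
  by rewrite memvZ ?Agt_c.
by rewrite scale0r mem0v.
Qed.

Lemma Agt_coef (P : forall l, pred (T l)) l s t a : a \in Agt P l -> coef l s t a = 0.
Proof. by move/AgtP; apply; rewrite /lt_cell eqxx andbF. Qed.

Lemma lt_le l m : lt l m -> le l m.
Proof. by case/andP. Qed.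

Lemma le_lt_trans l m k : le l m -> lt m k -> lt l k.
Proof.
case: cellA => -[_ le_anti le_trans] _ _ _ _ lm /andP[mk neq]; rewrite /lt_cell.
rewrite (le_trans _ _ _ lm mk); apply: contra neq => /eqP lk.
by rewrite (le_anti m k) // -lk.
Qed.

(** A numerical rank, strictly increasing along the order, that turns inductions on the poset into
    inductions on numbers bounded by [#|L|]. *)
Definition height (l : L) : nat := #|[set k | le k l]|.

Lemma height_lt l m : lt l m -> (height l < height m)%N.
Proof.
case: cellA => -[le_refl le_anti le_trans] _ _ _ _ lm.
apply: proper_card; apply/properP; split.
  by apply/subsetP=> k; rewrite !inE => kl; apply/(le_trans _ _ _ kl)/lt_le.
exists m; rewrite !inE //; apply: contraL lm => ml; rewrite /lt_cell.
by case: (boolP (le l m)) => //= /(le_anti _ _)-> //; rewrite eqxx.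
Qed.

Lemma height_max l : (height l <= #|L|)%N.
Proof. exact: max_card. Qed.

Lemma height_gt0 l : (0 < height l)%N.
Proof.
by case: cellA => -[le_refl _ _] _ _ _ _; apply/card_gt0P; exists l; rewrite inE.
Qed.

(** * Linear maps and the involution *)

Lemma lin0 (V W : lmodType F) (f : V -> W) : linear f -> f 0 = 0.
Proof.
by move=> lf; have := lf (-1) 0 0; rewrite scaler0 addr0 scaleN1r addNr.
Qed.

Lemma lin_sum (V W : lmodType F) (f : V -> W) (K : finType) (P : pred K) x :
  linear f -> f (\sum_(k | P k) x k) = \sum_(k | P k) f (x k).
Proof.
move=> lf; elim/big_rec2: _ => [|k u v _ <-]; first exact: lin0.
by rewrite -[x k]scale1r lf !scale1r.
Qed.

Lemma lin_scale (V W : lmodType F) (f : V -> W) k x :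
  linear f -> f (k *: x) = k *: f x.
Proof.
by move=> lf; have := lf k x 0; rewrite (lin0 _ _ f lf) !addr0.
Qed.

Lemma lin_expand (W : lmodType F) (f : A -> W) a : linear f ->
  f a = \sum_l \sum_s \sum_t coef l s t a *: f (c l s t).
Proof.
move=> lf; rewrite {1}(cell_expand a) lin_sum //; apply: eq_bigr => l _.
rewrite lin_sum //; apply: eq_bigr => s _.
by rewrite lin_sum //; apply: eq_bigr => t _; rewrite lin_scale.
Qed.

Lemma lin_Agt (P : forall l, pred (T l)) (W : vectType F) (U : {vspace W})
    (f : A -> W) l x : linear f ->
  (forall m s t, lt l m -> P m s -> P m t -> f (c m s t) \in U) ->
  x \in Agt P l -> f x \in U.
Proof.
move=> lf fU /AgtP x0; rewrite lin_expand //.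
apply: memv_suml => m _; apply: memv_suml => s _; apply: memv_suml => t _.
have [/and3P[lm Ps Pt]|/x0->] := boolP [&& lt l m, P m s & P m t].
  by rewrite memvZ ?fU.
by rewrite scale0r mem0v.
Qed.

Lemma linear_mull (a : A) : linear (fun x : A => a * x).
Proof. by move=> k x y; rewrite mulrDr scalerAr. Qed.

Lemma linear_mulr (a : A) : linear (fun x : A => x * a).
Proof. by move=> k x y; rewrite mulrDl scalerAl. Qed.

Lemma linear_star : linear star.
Proof. by case: cellA => _ _ _ [starP _ _ _] _. Qed.

Lemma starM x y : star (x * y) = star y * star x.
Proof. by case: cellA => _ _ _ []. Qed.

Lemma starK x : star (star x) = x.
Proof. by case: cellA => _ _ _ []. Qed.

Lemma star_c l s t : star (c l s t) = c l t s.
Proof. by case: cellA => _ _ _ []. Qed.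

Lemma starD x y : star (x + y) = star x + star y.
Proof. by have := linear_star 1 x y; rewrite !scale1r. Qed.

Lemma starZ k x : star (k *: x) = k *: star x.
Proof. by rewrite lin_scale //; apply: linear_star. Qed.

Lemma starB x y : star (x - y) = star x - star y.
Proof. by rewrite starD -scaleN1r starZ scaleN1r. Qed.

Lemma star1 : star 1 = 1.
Proof. by have := starM (star 1) 1; rewrite mulr1 starK mulr1. Qed.

Lemma starX x n : star (x ^+ n) = star x ^+ n.
Proof.
by elim: n => [|n IHn]; rewrite ?expr0 ?star1 // exprS starM IHn -exprSr.
Qed.

(** * Multiplication rules and structure constants *)

Lemma mul_c a l s t :
  a * c l s t - \sum_u r l a u s *: c l u t \in Agt all_idx l.
Proof. by case: cellA. Qed.

Lemma Agt_sub (P : forall l, pred (T l)) l m x :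
  lt l m -> x \in Agt P m -> x \in Agt P l.
Proof.
move=> lm /AgtP xP; apply/AgtP=> k s t kst; apply: xP.
apply: contra kst => /and3P[mk -> ->]; rewrite andbT.
by rewrite (le_lt_trans _ _ _ (lt_le _ _ lm)).
Qed.

Lemma Agt_mull l a x : x \in Agt all_idx l -> a * x \in Agt all_idx l.
Proof.
apply: (@lin_Agt _ _ _ ( *%R a)); first exact: linear_mull.
move=> m s t lm _ _; rewrite -[a * _](subrK (\sum_u r m a u s *: c m u t)).
rewrite memvD //; first exact: (Agt_sub _ _ _ _ lm (mul_c _ _ _ _)).
by apply: memv_suml => u _; rewrite memvZ ?Agt_c.
Qed.

Lemma Agt_star l x : x \in Agt all_idx l -> star x \in Agt all_idx l.
Proof.
apply: lin_Agt; first exact: linear_star.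
by move=> m s t lm _ _; rewrite star_c Agt_c.
Qed.

Lemma Agt_mulr l a x : x \in Agt all_idx l -> x * a \in Agt all_idx l.
Proof.
by move=> xl; rewrite -[x * a]starK starM Agt_star // Agt_mull // Agt_star.
Qed.

(** The involution carries the left rule for [star a] to a right rule for [a]. *)
Lemma c_mul a l s t :
  c l s t * a - \sum_u r l (star a) u t *: c l s u \in Agt all_idx l.
Proof.
have := Agt_star _ _ (mul_c (star a) l t s); rewrite starB starM starK star_c.
rewrite (lin_sum _ _ _ _ _ _ linear_star).
by under eq_bigr => u _ do rewrite starZ star_c.
Qed.

Lemma T_inh l : exists t : T l, true.
Proof.
by case: cellA => _ /(_ l) /card_gt0P[t _] _ _ _; exists t.
Qed.

Lemma coef_sum_c l u v (k : T l -> F) t :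
  coef l u v (\sum_w k w *: c l w t) = k u * (v == t)%:R.
Proof.
rewrite coef_sum (bigD1 u) //= coefZ coef_c eqxx /= big1 ?addr0 // => w wu.
by rewrite coefZ coef_c eq_sym (negPf wu) mulr0.
Qed.

Lemma coef_sum_cr l u v (k : T l -> F) s :
  coef l u v (\sum_w k w *: c l s w) = k v * (u == s)%:R.
Proof.
rewrite coef_sum (bigD1 v) //= coefZ coef_c eqxx andbT big1 ?addr0 // => w wv.
by rewrite coefZ coef_c andbC eq_sym (negPf wv) mulr0.
Qed.

Lemma coef_mul_c a l u v s t :
  coef l u v (a * c l s t) = r l a u s * (v == t)%:R.
Proof.
by have /eqP := Agt_coef _ _ u v _ (mul_c a l s t);
   rewrite coefB subr_eq0 coef_sum_c => /eqP.
Qed.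

Lemma coef_c_mul a l u v s t :
  coef l u v (c l s t * a) = r l (star a) v t * (u == s)%:R.
Proof.
by have /eqP := Agt_coef _ _ u v _ (c_mul a l s t);
   rewrite coefB subr_eq0 coef_sum_cr => /eqP.
Qed.

(** The index [t] is arbitrary: any element of the nonempty [T l] identifies the given constants
    with coordinates, and this yields their linearity in [a]. *)
Lemma r_coef l a u s t : r l a u s = coef l u t (a * c l s t).
Proof. by rewrite coef_mul_c eqxx mulr1. Qed.

(** * Representations on the cell modules and their bilinear forms *)

Lemma linear_crho l : linear (crho l).
Proof.
move=> k x y; apply/matrixP=> i j; rewrite !mxE; have [t _] := T_inh l.
by rewrite !(r_coef _ _ _ _ t) mulrDl -scalerAl coef_linear.
Qed.

Lemma crhoD l x y : crho l (x + y) = crho l x + crho l y.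
Proof. by have := linear_crho l 1 x y; rewrite !scale1r. Qed.

Lemma crhoZ l k x : crho l (k *: x) = k *: crho l x.
Proof. by rewrite lin_scale //; apply: linear_crho. Qed.

Lemma crhoB l x y : crho l (x - y) = crho l x - crho l y.
Proof. by rewrite crhoD -scaleN1r crhoZ scaleN1r. Qed.

Lemma crho_sum l (K : finType) (P : pred K) (x : K -> A) :
  crho l (\sum_(k | P k) x k) = \sum_(k | P k) crho l (x k).
Proof. by rewrite (lin_sum _ _ (crho l)) //; apply: linear_crho. Qed.

Lemma crho1 l : crho l 1 = 1%:M.
Proof.
apply/matrixP=> i j; rewrite !mxE; have [t _] := T_inh l.
by rewrite (r_coef _ _ _ _ t) mul1r coef_c eqxx andbT (inj_eq enum_val_inj) eq_sym.
Qed.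

(** The row-vector convention reverses products. The error term of the rule for [b] stays among the
    higher cells after multiplication by [a], so it has no coordinate at [l]. *)
Lemma crhoM l a b : crho l (a * b) = crho l b *m crho l a.
Proof.
apply/matrixP=> i j; rewrite !mxE; have [t _] := T_inh l.
set s := enum_val i; set v := enum_val j; rewrite (r_coef _ _ _ _ t) -mulrA.
rewrite -[b * _](subrK (\sum_u r l b u s *: c l u t)) mulrDr coefD.
rewrite (Agt_coef _ _ _ _ _ (Agt_mull _ a _ (mul_c b l s t))) add0r.
rewrite mulr_sumr coef_sum (reindex (@enum_val (T l) (T l))) /=; last first.
  by exists enum_rank => k _; rewrite ?enum_rankK ?enum_valK.
by apply: eq_bigr => k _; rewrite -scalerAr coefZ coef_mul_c eqxx mulr1 !mxE.
Qed.

Lemma crho_Agt l x : x \in Agt all_idx l -> crho l x = 0.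
Proof.
move=> xl; apply/matrixP=> i j; rewrite !mxE; have [t _] := T_inh l.
by rewrite (r_coef _ _ _ _ t) (Agt_coef _ _ _ _ _ (Agt_mulr _ _ _ xl)).
Qed.

(** By the right rule, a product starting with [c m u s] involves only the cell [m] and cells above
    it, hence not [l]. *)
Lemma crho_c_le l m u s : ~~ le m l -> crho l (c m u s) = 0.
Proof.
move=> ml; apply/matrixP=> i j; rewrite !mxE; have [t _] := T_inh l.
rewrite (r_coef _ _ _ _ t); set a := c l _ _.
have lm : l != m.
  by apply: contra ml => /eqP->; case: cellA => -[le_refl _ _] *.
have /AgtP/(_ l (enum_val j) t) := c_mul a m u s.
rewrite /lt_cell (negPf ml) coefB coef_sum => /(_ isT)/eqP.
rewrite subr_eq0 => /eqP->; rewrite big1 // => v _.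
by rewrite coefZ coef_c_neq ?mulr0.
Qed.

(** The value of the cell form on the basis vectors at [s] and [t], given explicitly rather than
    through the choice operator in [cform]. *)
Definition phi (l : L) (s t : T l) : F := r l (c l s s) s t.

(** Both sides compute the coordinate of [c l u s * c l t b] at [(v, b)], one by the left rule and
    one by the right rule. *)
Lemma r_c_swap l u s v t b :
  r l (c l u s) v t = r l (c l b t) b s * (v == u)%:R.
Proof.
rewrite (r_coef _ _ _ _ b) -[RHS](mulr1) -mulrA.
by rewrite coef_c_mul star_c mulr1.
Qed.

Lemma r_c l u s v t : r l (c l u s) v t = phi l s t * (v == u)%:R.
Proof.
rewrite (r_c_swap _ _ _ _ _ u); congr (_ * _).
by rewrite /phi [RHS](r_c_swap _ _ _ _ _ u) eqxx mulr1.
Qed.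

Lemma phiC l s t : phi l s t = phi l t s.
Proof. by rewrite {1}/phi (r_c_swap _ _ _ _ _ t) eqxx mulr1. Qed.

Definition gram (l : L) : 'M[F]_(csize L T l) :=
  \matrix_(i, j) phi l (enum_val i) (enum_val j).

Lemma tr_gram l : (gram l)^T = gram l.
Proof. by apply/matrixP=> i j; rewrite !mxE phiC. Qed.

(** This is the operator sending a vector $v$ to $\langle v, c_s\rangle c_u$. *)
Lemma crho_c l u s :
  crho l (c l u s) = gram l *m delta_mx (enum_rank s) (enum_rank u).
Proof.
apply/matrixP=> i j; rewrite !mxE r_c (bigD1 (enum_rank s)) //= big1 => [|k ks].
  rewrite !mxE enum_rankK phiC eqxx addr0 /=.
  by rewrite -(inj_eq enum_rank_inj) enum_valK.
by rewrite !mxE (negPf ks) mulr0.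
Qed.

Lemma mulmx_delta m n p (M : 'M[F]_(m, n)) i j (k h : 'I_p) :
  (M *m delta_mx j k) i h = M i j * (h == k)%:R.
Proof.
rewrite mxE (bigD1 j) //= big1 => [|v vj]; first by rewrite mxE eqxx addr0.
by rewrite [Y in _ * Y]mxE (negPf vj) mulr0.
Qed.

Lemma mulmx_delta_mulmx m n p q (M : 'M[F]_(m, n)) (N : 'M[F]_(p, q)) i j k h :
  (M *m delta_mx j k *m N) i h = M i j * N k h.
Proof.
rewrite mxE (bigD1 k) //= big1 => [|v vk].
  by rewrite mulmx_delta eqxx mulr1 addr0.
by rewrite mulmx_delta (negPf vk) mulr0 mul0r.
Qed.

(** Invariance of the cell form, $\langle av,w\rangle=\langle v,a^*w\rangle$. It comes from
    computing the action of [c l x t * a] by multiplicativity and by the right rule. *)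
Lemma crho_adj l a : crho l a *m gram l = gram l *m (crho l (star a))^T.
Proof.
apply/matrixP=> i j; have [x _] := T_inh l.
pose t := enum_val j.
have := crhoM l (c l x t) a.
have -> : crho l (c l x t * a) =
    crho l (\sum_u r l (star a) u t *: c l x u).
  by apply/eqP; rewrite -subr_eq0 -crhoB crho_Agt // c_mul.
rewrite crho_sum crho_c mulmxA => /matrixP /(_ i (enum_rank x)).
rewrite [RHS]mulmx_delta eqxx mulr1 enum_valK => <-.
rewrite summxE [RHS]mxE (reindex (@enum_val (T l) (T l))) /=; last first.
  by exists enum_rank => k _; rewrite ?enum_rankK ?enum_valK.
apply: eq_bigr => k _; rewrite crhoZ !mxE r_c enum_rankK eqxx mulr1 mulrC.
by rewrite phiC.
Qed.

(** * Truncation to selected indices: forms and radicals *)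

Lemma coef_comb (k : forall l, T l -> T l -> F) l s t :
  coef l s t (\sum_m \sum_u \sum_v k m u v *: c m u v) = k l s t.
Proof.
rewrite coef_sum (bigD1 l) //= [Y in _ + Y]big1 ?addr0 => [|m ml]; last first.
  rewrite coef_sum big1 // => u _; rewrite coef_sum big1 // => v _.
  by rewrite coefZ coef_c_neq ?mulr0 // eq_sym.
rewrite coef_sum (bigD1 s) //= [Y in _ + Y]big1 ?addr0 => [|u us]; last first.
  rewrite coef_sum big1 // => v _.
  by rewrite coefZ coef_c eq_sym (negPf us) mulr0.
by rewrite coef_sum_cr eqxx mulr1.
Qed.

(* The projection of [Delta(l)] onto the span of the [c_s] with [P l s]; for
   [P = T(., i)] it is the action of [e_i]. *)
Definition Emx (P : forall l, pred (T l)) (l : L) : 'M[F]_(csize L T l) :=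
  diag_mx (\row_j (P l (enum_val j))%:R).

Lemma Emx_idem (P : forall l, pred (T l)) l : Emx P l *m Emx P l = Emx P l.
Proof.
rewrite /Emx mulmx_diag; congr diag_mx; apply/rowP=> j; rewrite !mxE.
by rewrite -natrM mulnb andbb.
Qed.

Lemma tr_Emx (P : forall l, pred (T l)) l : (Emx P l)^T = Emx P l.
Proof. exact: tr_diag_mx. Qed.

Lemma sub_Emx (P : forall l, pred (T l)) l p (v : 'M[F]_(p, csize L T l)) :
  (v <= Emx P l)%MS = (v *m Emx P l == v).
Proof.
apply/idP/eqP => [/submxP[w ->]|<-]; first by rewrite -mulmxA Emx_idem.
exact: submxMl.
Qed.

Lemma cvec_Emx (P : forall l, pred (T l)) l s :
  cvec F L T l s *m Emx P l = (P l s)%:R *: cvec F L T l s.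
Proof.
apply/rowP=> j; rewrite mul_mx_diag !mxE eqxx /= mulrC.
by case: eqP => [->|_]; rewrite ?enum_rankK ?mulr0.
Qed.

Lemma eq_Dmod (P : forall l, pred (T l)) l : (Dmod F L T P l :=: Emx P l)%MS.
Proof.
apply/eqmxP/andP; split.
  apply/sumsmx_subP=> s Ps; rewrite genmxE sub_Emx.
  by rewrite cvec_Emx Ps scale1r.
apply/row_subP=> i; rewrite row_diag_mx mxE.
case: (boolP (P l _)) => [Pi|_]; last by rewrite scale0r sub0mx.
rewrite scale1r -[i]enum_valK (sumsmx_sup (enum_val i)) ?enum_rankK // genmxE.
by rewrite /cvec enum_valK.
Qed.

(** The value picked by [epsilon] is forced: two values meeting the specification agree in the
    coordinate at [(s, s)], which is available because [s] is selected. *)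
Lemma cform_eq (P : forall l, pred (T l)) l s t : P l s ->
  cform_spec F A L le T c P l s t (phi l s t) ->
  cform F A L le T c P l s t = phi l s t.
Proof.
move=> Ps spec_phi.
have := epsilon_spec (inhabits 0) _ (ex_intro _ _ spec_phi).
rewrite -/(cform F A L le T c P l s t) => /(_ s s Ps Ps).
move/(Agt_coef _ _ s s); have /(Agt_coef _ _ s s) := spec_phi s s Ps Ps.
rewrite !coefB !coefZ coef_c !eqxx !mulr1.
by move=> /subr0_eq-> /subr0_eq.
Qed.

Lemma c_mul_c l u s t b : c l u s * c l t b - phi l s t *: c l u b \in Agt all_idx l.
Proof.
have := mul_c (c l u s) l t b.
rewrite (bigD1 u) //= r_c eqxx mulr1 big1 ?addr0 // => v vu.
by rewrite r_c (negPf vu) mulr0 scale0r.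
Qed.

Lemma Gram_mask (P : forall l, pred (T l)) l :
  (forall s t, P l s -> P l t -> cform F A L le T c P l s t = phi l s t) ->
  Gram F A L le T c P l = Emx P l *m gram l *m Emx P l.
Proof.
move=> cformE; apply/matrixP=> i j; rewrite mul_mx_diag mul_diag_mx !mxE.
case: (boolP (P l (enum_val i))) => [Pi|_] /=; last by rewrite !mul0r.
case: (boolP (P l (enum_val j))) => [Pj|_] /=; last by rewrite mulr0.
by rewrite cformE // mul1r mulr1.
Qed.

(** Only the row space of [Dmod] is under control. It and the symmetric projection [Emx] factor
    through each other, so the transposed [Dmod] may be replaced by [Emx]. *)
Lemma sub_Radm (P : forall l, pred (T l)) l p (v : 'M[F]_(p, csize L T l)) :
  (v <= Radm F A L le T c P l)%MS =
  (v *m Emx P l == v) && (v *m (Gram F A L le T c P l *m Emx P l) == 0).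
Proof.
rewrite sub_capmx eq_Dmod sub_Emx; congr (_ && _).
rewrite -[Y in _ = (_ *m (_ *m Y) == 0)]tr_Emx.
have /submxP[x Dx] : (Dmod F L T P l <= Emx P l)%MS by rewrite eq_Dmod.
have /submxP[y Ey] : (Emx P l <= Dmod F L T P l)%MS by rewrite eq_Dmod.
apply/sub_kermxP/eqP => v0.
  by rewrite Ey trmx_mul !mulmxA -(mulmxA v) v0 mul0mx.
by rewrite Dx trmx_mul !mulmxA -(mulmxA v) v0 mul0mx.
Qed.

Lemma Emx_all l : Emx all_idx l = 1%:M.
Proof.
apply/matrixP=> i j; rewrite !mxE /allidx; congr (_ *+ _).
Qed.

Lemma Gram_all l : Gram F A L le T c all_idx l = gram l.
Proof.
rewrite Gram_mask ?Emx_all ?mulmx1 ?mul1mx // => s t _ _.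
by apply: cform_eq => // u b _ _; apply: c_mul_c.
Qed.

Lemma acts_nonzeroE z l :
  acts_nonzero F A L le T c r z l = (crho l z *m gram l != 0).
Proof.
rewrite /acts_nonzero; congr (~~ _).
rewrite sub_Radm Gram_all Emx_all !mulmx1 eqxx /=.
have /submxP[x Dx] : (1%:M <= Dmod F L T all_idx l)%MS by rewrite eq_Dmod Emx_all.
apply/eqP/eqP => [D0|z0]; last by rewrite -mulmxA z0 mulmx0.
by rewrite -[crho l z]mul1mx Dx -!mulmxA [Y in _ *m Y]mulmxA D0 mulmx0.
Qed.

(** * The idempotents and their corner algebras *)

Variables (I : finType) (e : I -> A).
Hypothesis idemE : idem_decomp F A L T c star I e.
Local Notation Ti := (Tidx F A L T c I e).

Lemma sum_e : \sum_i e i = 1.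
Proof. by case: idemE. Qed.

Lemma ee i : e i * e i = e i.
Proof. by case: idemE => _ []. Qed.

Lemma ee0 i j : i != j -> e i * e j = 0.
Proof. by case: idemE => _ [_ _ ee0] _ _; apply: ee0. Qed.

Lemma star_e i : star (e i) = e i.
Proof. by case: idemE. Qed.

Lemma Tidx_ex l t : exists i, Ti i l t.
Proof.
case: idemE => _ _ /(_ l t)[i it] _; exists i.
by apply/forallP=> s; rewrite it.
Qed.

(** Every index is fixed by some [e j], and by orthogonality any other idempotent annihilates it. *)
Lemma e_mul_c i l s t : e i * c l s t = (Ti i l s)%:R *: c l s t.
Proof.
have [/forallP/(_ t)/eqP->|is_n] := boolP (Ti i l s); first by rewrite scale1r.
have [j js] := Tidx_ex l s; have /forallP/(_ t)/eqP <- := js.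
rewrite mulrA ee0 ?mul0r ?scale0r //.
by apply: contraNneq is_n => ->.
Qed.

Lemma c_mul_e i l s t : c l s t * e i = (Ti i l t)%:R *: c l s t.
Proof. by rewrite -[LHS]starK starM star_e star_c e_mul_c starZ star_c. Qed.

Lemma coef_e_mul i l s t a : coef l s t (e i * a) = (Ti i l s)%:R * coef l s t a.
Proof.
rewrite (lin_expand _ _ _ (linear_mull (e i))).
under eq_bigr => m _ do under eq_bigr => u _ do
  under eq_bigr => v _ do rewrite e_mul_c scalerA.
by rewrite (coef_comb (fun m u v => coef m u v a * (Ti i m u)%:R)) mulrC.
Qed.

Lemma coef_mul_e i l s t a : coef l s t (a * e i) = (Ti i l t)%:R * coef l s t a.
Proof.
rewrite (lin_expand _ _ _ (linear_mulr (e i))).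
under eq_bigr => m _ do under eq_bigr => u _ do
  under eq_bigr => v _ do rewrite c_mul_e scalerA.
by rewrite (coef_comb (fun m u v => coef m u v a * (Ti i m v)%:R)) mulrC.
Qed.

Lemma eAe_coef i a l s t : in_eAe F A I e i a ->
  ~~ (Ti i l s && Ti i l t) -> coef l s t a = 0.
Proof.
move=> /eqP <-; rewrite coef_mul_e coef_e_mul mulrA -natrM mulnb andbC.
by move/negPf->; rewrite mul0r.
Qed.

Lemma eAeP i a : reflect (e i * a = a /\ a * e i = a) (in_eAe F A I e i a).
Proof.
apply: (iffP eqP) => [<-|[-> ->] //].
by rewrite !mulrA ee -!mulrA ee.
Qed.

Lemma eAe_c i l s t : Ti i l s -> Ti i l t -> in_eAe F A I e i (c l s t).
Proof.
by move=> ls lt; apply/eAeP; rewrite e_mul_c c_mul_e ls lt scale1r.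
Qed.

(** Elements of the corner algebra have coordinates only at selected indices, so for them the two
    spans of higher cells coincide. *)
Lemma Agt_e i l x :
  in_eAe F A I e i x -> x \in Agt all_idx l -> x \in Agt (Ti i) l.
Proof.
move=> xe /AgtP xl; apply/AgtP=> m s t; rewrite negb_and.
case/orP=> [lm|]; last exact: eAe_coef.
by apply: xl; rewrite (negPf lm).
Qed.

Lemma crho_e i l : crho l (e i) = Emx (Ti i) l.
Proof.
apply/matrixP=> j k; rewrite !mxE; have [t _] := T_inh l.
rewrite (r_coef _ _ _ _ t) coef_e_mul coef_c eqxx andbT (inj_eq enum_val_inj).
by rewrite eq_sym; case: eqP => [->|_]; rewrite ?mulr1 ?mulr0.
Qed.

Lemma e_gram i l : crho l (e i) *m gram l = gram l *m crho l (e i).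
Proof. by rewrite crho_adj star_e crho_e tr_Emx. Qed.

Lemma crho_ee i l : crho l (e i) *m crho l (e i) = crho l (e i).
Proof. by rewrite -crhoM ee. Qed.

Lemma Gram_e i l : Gram F A L le T c (Ti i) l = crho l (e i) *m gram l.
Proof.
rewrite Gram_mask => [|s t Ts Tt].
  by rewrite -crho_e -mulmxA -e_gram mulmxA crho_ee.
apply: cform_eq => // u b Tu Tb; apply: Agt_e; last exact: c_mul_c.
apply/eAeP; rewrite mulrBr mulrBl -!scalerAr -!scalerAl !mulrA -!(mulrA _ _ (e i)).
by rewrite !e_mul_c !c_mul_e Tu Tb !scale1r.
Qed.

Lemma sub_Dmod_e i l p (v : 'M[F]_(p, csize L T l)) :
  (v <= Dmod F L T (Ti i) l)%MS = (v *m crho l (e i) == v).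
Proof. by rewrite eq_Dmod sub_Emx crho_e. Qed.

Lemma sub_Radm_e i l p (v : 'M[F]_(p, csize L T l)) :
  (v <= Radm F A L le T c (Ti i) l)%MS =
  (v *m crho l (e i) == v) && (v *m gram l == 0).
Proof.
rewrite sub_Radm Gram_e -crho_e -[_ *m gram l *m _]mulmxA -e_gram.
by rewrite [_ *m (_ *m gram l)]mulmxA crho_ee mulmxA; case: eqP => //= ->.
Qed.

(** * Composition series and their simple factors *)

Lemma exists_minimal_submod S l (N1 N2 : 'M[F]_(csize L T l)) :
  is_submod F A L T r S l N2 -> (N1 < N2)%MS ->
  exists N, [/\ is_submod F A L T r S l N, (N1 < N)%MS, (N <= N2)%MS &
    forall U, is_submod F A L T r S l U -> ~ (N1 < U < N)%MS].
Proof.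
have [n] := ubnP (\rank N2); elim: n N2 => // n IHn N2 rN2 sN2 ltN.
have [[U [sU /andP[N1U UN2]]]|noU] :=
  excluded_middle_informative
    (exists U, is_submod F A L T r S l U /\ (N1 < U < N2)%MS); last first.
  by exists N2; split=> // U sU NUN; apply: noU; exists U.
have [] := IHn U _ sU N1U.
  by rewrite (leq_trans (rank_ltmx UN2)).
move=> N [sN N1N NU simN]; exists N; split=> //.
exact: submx_trans NU (ltmxW UN2).
Qed.

(** The series is built upwards: a minimal submodule above [N1] takes its place, which lowers the
    difference of ranks. *)
Lemma exists_comp_chain S l (N1 N2 : 'M[F]_(csize L T l)) :
  is_submod F A L T r S l N1 -> is_submod F A L T r S l N2 -> (N1 <= N2)%MS ->
  exists k (M : nat -> 'M[F]_(csize L T l)),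
  [/\ M 0%N = N1, (M k == N2)%MS, forall j, is_submod F A L T r S l (M j),
      forall j, (j < k)%N -> (M j < M j.+1)%MS &
      forall j U, (j < k)%N -> is_submod F A L T r S l U ->
        ~ (M j < U < M j.+1)%MS].
Proof.
have [n] := ubnP (\rank N2 - \rank N1).
elim: n N1 => // n IHn N1 rN sN1 sN2 N12.
have [N21|N21] := boolP (N2 <= N1)%MS.
  by exists 0%N, (fun=> N1); split=> //; rewrite N12 N21.
have ltN : (N1 < N2)%MS by rewrite ltmxE N12.
have [N [sN N1N NN2 simN]] := exists_minimal_submod _ _ _ _ sN2 ltN.
have [||//|//|k [M [M0 Mk sM ltM simM]]] := IHn N.
- rewrite (leq_trans _ (ltnSE rN)) // ltn_sub2l ?rank_ltmx //.
- by [].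
exists k.+1, (fun j => if j is j'.+1 then M j' else N1); split=> //.
- by case.
- by case=> [|j] jk; rewrite ?M0 //; apply: ltM.
- by case=> [|j] U jk; rewrite ?M0; [apply: simN | apply: simM].
Qed.

Lemma Dmod_mul_sub (P : forall l, pred (T l)) m p q
    (g : 'M[F]_(csize L T m, p)) (N : 'M[F]_(q, p)) :
  (forall s, P m s -> (cvec F L T m s *m g <= N)%MS) ->
  (Dmod F L T P m *m g <= N)%MS.
Proof.
move=> gN; rewrite /Dmod sumsmxMr_gen; apply/sumsmx_subP=> s Ps.
by rewrite genmxE (eqmxMr _ (genmxE _)) gN.
Qed.

Lemma crho_sub l p q (N2 : 'M[F]_(p, csize L T l)) (N1 : 'M[F]_(q, csize L T l)) a :
  (forall m s t, coef m s t a != 0 -> (N2 *m crho l (c m s t) <= N1)%MS) ->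
  (N2 *m crho l a <= N1)%MS.
Proof.
move=> aN; rewrite (lin_expand _ (crho l) a (linear_crho l)).
rewrite mulmx_sumr; apply: summx_sub => m _.
rewrite mulmx_sumr; apply: summx_sub => s _.
rewrite mulmx_sumr; apply: summx_sub => t _.
have [->|nz] := eqVneq (coef m s t a) 0; first by rewrite scale0r mulmx0 sub0mx.
by rewrite -scalemxAr scalemx_sub // aN.
Qed.

Lemma cvec_crho m s a :
  cvec F L T m s *m crho m a = \sum_u r m a u s *: cvec F L T m u.
Proof.
apply/rowP=> j; rewrite /cvec -rowE !mxE enum_rankK summxE.
rewrite (bigD1 (enum_val j)) //= big1 => [|u uj].
  by rewrite !mxE enum_valK !eqxx mulr1 addr0.
rewrite !mxE eqxx /=; case: eqP => [ju|]; last by rewrite mulr0.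
by rewrite ju enum_rankK eqxx in uj.
Qed.

Lemma Dmod_submod i m :
  is_submod F A L T r (in_eAe F A I e i) m (Dmod F L T (Ti i) m).
Proof.
by move=> a /eAeP[ea _]; rewrite sub_Dmod_e -mulmxA -crhoM ea.
Qed.

Lemma Radm_submod i m :
  is_submod F A L T r (in_eAe F A I e i) m (Radm F A L le T c (Ti i) m).
Proof.
move=> a /eAeP[ea _]; rewrite sub_Radm_e -mulmxA -crhoM ea eqxx /=.
have: (Radm F A L le T c (Ti i) m <= Radm F A L le T c (Ti i) m)%MS by [].
rewrite sub_Radm_e => /andP[_ /eqP radG].
by rewrite -mulmxA crho_adj mulmxA radG mul0mx.
Qed.

(* A simple subquotient [N2 / N1] of [V(l, i)] is [L_i(m)] for [m] maximal such that
   some [c m s0 t0] acts nontrivially on it: for a suitable [x] in [N2] the map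
   [c_u |-> c_{u t0} x] is linear modulo [N1], since the higher cells act by zero. *)
Section SimpleFactor.
Variables (i : I) (l : L) (N1 N2 : 'M[F]_(csize L T l)).
Local Notation S := (in_eAe F A I e i).
Hypotheses (sN1 : is_submod F A L T r S l N1) (sN2 : is_submod F A L T r S l N2).
Hypotheses (ltN : (N1 < N2)%MS) (N2D : (N2 <= Dmod F L T (Ti i) l)%MS).
Hypothesis simN : forall U, is_submod F A L T r S l U -> ~ (N1 < U < N2)%MS.

Let moves m s t := [&& Ti i m s, Ti i m t & ~~ (N2 *m crho l (c m s t) <= N1)%MS].

(** Otherwise [e i], a combination of selected basis elements that fixes [N2], would send [N2] into
    [N1]. *)
Let moves_ex : exists m, [exists s, exists t, moves m s t].
Proof.
apply/existsP; apply: contraT; rewrite negb_exists => /forallP still.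
case/andP: ltN => _ /negP; case.
move: N2D; rewrite sub_Dmod_e => /eqP <-; apply: crho_sub => m s t nz.
have Se : S (e i) by apply/eAeP; rewrite ee.
have /negPn/andP[Ts Tt] := contra_neqN (eAe_coef _ _ m s t Se) nz.
apply: contraT => nN; case/existsP: (still m); exists s; apply/existsP; exists t.
by rewrite /moves Ts Tt.
Qed.

Lemma simple_factor : exists m, [/\ in_Lambda0 F A L le T c (Ti i) m,
  in_LambdaP L T (Ti i) m & subquo_iso_simple F A L le T c r S (Ti i) m l N1 N2].
Proof.
have [m0 m0P] := moves_ex.
case: (@arg_maxnP L m0 (fun m => [exists s, exists t, moves m s t]) height m0P)
  => {m0 m0P} m /existsP[s0 /existsP[t0]].
case/and3P=> Ts0 Tt0 mv maxm.
(* A higher cell moving [N2] outside [N1] would contradict the maximal height of [m]. *)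
have Agt_kill x : x \in Agt (Ti i) m -> (N2 *m crho l x <= N1)%MS.
  move/AgtP=> xm; apply: crho_sub => k s t nz.
  have /negPn/and3P[mk Ts Tt] := contra_neqN (xm k s t) nz.
  apply: contraT => nN; have := maxm k; rewrite /= leqNgt height_lt //; apply.
  by apply/existsP; exists s; apply/existsP; exists t; rewrite /moves Ts Tt.
have /row_subPn[j] := mv; rewrite row_mul; set x := row j N2 => xmv.
have xN2 : (x <= N2)%MS by apply: row_sub.
pose f : 'M[F]_(csize L T m, csize L T l) :=
  \matrix_(k < csize L T m) (x *m crho l (c m (enum_val k) t0)).
have cf u : cvec F L T m u *m f = x *m crho l (c m u t0).
  by rewrite /cvec -rowE rowK enum_rankK.
set D := Dmod F L T (Ti i) m; set Rd := Radm F A L le T c (Ti i) m.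
have Df : (D *m f <= N2)%MS.
  apply: Dmod_mul_sub => u Tu; rewrite cf.
  by apply: submx_trans (submxMr _ xN2) (sN2 _ _); apply: eAe_c.
(* The failure of [f] to be linear is the action on [x] of the error term in the multiplication
   rule, which [Agt_kill] sends into [N1]. *)
have hom a : S a -> (D *m (crho m a *m f - f *m crho l a) <= N1)%MS.
  move=> Sa; apply: Dmod_mul_sub => s Ts; have /eAeP[ea ae] := Sa.
  rewrite mulmxBr !mulmxA cf cvec_crho mulmx_suml.
  under eq_bigr => u _ do rewrite -scalemxAl cf scalemxAr -crhoZ.
  rewrite -mulmx_sumr -crho_sum -mulmxA -crhoM -mulmxBr -crhoB.
  apply: submx_trans (submxMr _ xN2) _; apply: Agt_kill; apply: Agt_e.
    apply/eAeP; rewrite mulrBr mulrBl mulr_sumr mulr_suml !mulrA ea.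
    rewrite -mulrA c_mul_e Tt0 scale1r; split; congr (_ - _).
      apply: eq_bigr => u _; rewrite -scalerAr e_mul_c scalerA; congr (_ *: _).
      have ru : r m a u s = (Ti i m u)%:R * r m a u s.
        by rewrite (r_coef _ _ _ _ t0) -[in LHS]ea -mulrA coef_e_mul.
      by rewrite ru mulrC mulrA -natrM mulnb andbb.
    by apply: eq_bigr => u _; rewrite -scalerAl c_mul_e Tt0 scale1r.
  by rewrite -memvN opprB mul_c.
(* The image of an invariant part of [D], enlarged by [N1], is a submodule between [N1] and [N2];
   simplicity leaves only the two ends. *)
have dich p (W : 'M[F]_(p, csize L T m)) : (W <= D)%MS ->
    (forall a, S a -> (W *m crho m a <= W)%MS) ->
    (W *m f <= N1)%MS \/ (N2 <= W *m f + N1)%MS.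
  move=> WD sW; set U := (W *m f + N1)%MS.
  have [WN|WN] := boolP (W *m f <= N1)%MS; [by left | right].
  apply: contraT => NU; case: (simN U).
    move=> a Sa; rewrite addsmxMr addsmx_sub; apply/andP; split; last first.
      by rewrite (submx_trans (sN1 _ Sa)) // addsmxSr.
    rewrite -mulmxA -[f *m _](subKr (crho m a *m f)) mulmxBr mulmxA addmx_sub //.
      by rewrite (submx_trans (submxMr f (sW _ Sa))) // addsmxSl.
    rewrite eqmx_opp (submx_trans (submxMr _ WD)) //.
    by rewrite (submx_trans (hom a Sa)) // addsmxSr.
  have N1U : (N1 <= U)%MS by apply: addsmxSr.
  have UN2 : (U <= N2)%MS.
    by rewrite addsmx_sub (ltmxW ltN) (submx_trans (submxMr _ WD) Df).
  rewrite !ltmxE N1U UN2 NU !andbT /=; apply: contra WN.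
  exact: submx_trans (addsmxSl _ _).
have cs0 : ~~ (cvec F L T m s0 *m f <= N1)%MS by rewrite cf.
have s0D : (cvec F L T m s0 <= D)%MS.
  by rewrite sub_Dmod_e crho_e cvec_Emx Ts0 scale1r.
have DfN : ~~ (D *m f <= N1)%MS.
  by apply: contra cs0 => /(submx_trans (submxMr f s0D)).
have [//|D2] := dich _ D (submx_refl _) (Dmod_submod i m); first by rewrite (negPf DfN).
have RdP : (Rd <= Rd)%MS by []; rewrite sub_Radm_e in RdP.
case/andP: RdP => /eqP RdE /eqP RdG.
have RdD : (Rd <= D)%MS by rewrite sub_Dmod_e RdE.
(* If the radical covered [N2] modulo [N1], then [c m s0 t0], which kills the radical, would send
   [N2] into [N1]. *)
have RdK : (Rd *m f <= N1)%MS.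
  have [//|R2] := dich _ Rd RdD (Radm_submod i m).
  case/negP: mv; apply: submx_trans (submxMr _ R2) _.
  have Sc : S (c m s0 t0) by apply: eAe_c.
  rewrite addsmxMr addsmx_sub sN1 // andbT.
  rewrite -mulmxA -[f *m _](subKr (crho m (c m s0 t0) *m f)) mulmxBr mulmxA.
  rewrite crho_c mulmxA RdG !mul0mx sub0r eqmx_opp -crho_c.
  exact: submx_trans (submxMr _ RdD) (hom _ Sc).
exists m; split.
- rewrite /in_Lambda0 Gram_e; apply: contra DfN => /eqP G0.
  have DRd : (D <= Rd)%MS.
    have /eqP DE : D *m crho m (e i) == D by rewrite -sub_Dmod_e.
    by rewrite sub_Radm_e DE eqxx -DE -mulmxA G0 mulmx0 eqxx.
  exact: submx_trans (submxMr _ DRd) RdK.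
- by apply/existsP; exists s0.
exists f; split=> //.
- by rewrite addsmx_sub Df (ltmxW ltN) D2.
apply/andP; split; last first.
  by rewrite sub_capmx RdD; apply/sub_kermxP/eqP; rewrite mulmxA -submxE.
set K := (D :&: _)%MS.
have KD : (K <= D)%MS by apply: capmxSl.
have Kf : (K *m f <= N1)%MS.
  by rewrite submxE -mulmxA; apply/eqP/sub_kermxP/capmxSr.
have /eqP KE : K *m crho m (e i) == K by rewrite -sub_Dmod_e.
rewrite sub_Radm_e KE eqxx /=; apply/eqP/matrixP=> h k; rewrite [RHS]mxE.
have [Tk|Tk] := boolP (Ti i m (enum_val k)); last first.
  by rewrite -KE -mulmxA e_gram crho_e mulmxA mul_mx_diag !mxE (negPf Tk) mulr0.
have Sc : S (c m s0 (enum_val k)) by apply: eAe_c.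
(* For $v$ in the kernel, this element sends $v$ to a multiple of [cvec] at [s0] by a form value.
   The result is mapped into [N1] although the vector at [s0] is not, so the form value is zero. *)
have : (K *m crho m (c m s0 (enum_val k)) *m f <= N1)%MS.
  rewrite -mulmxA -[_ *m f](subrK (f *m crho l (c m s0 (enum_val k)))) mulmxDr.
  rewrite addmx_sub ?(submx_trans (submxMr _ KD) (hom _ Sc)) // mulmxA.
  exact: submx_trans (submxMr _ Kf) (sN1 _ Sc).
rewrite crho_c enum_valK mulmxA -(mul_delta_mx (0 : 'I_1)) !mulmxA => /row_subP/(_ h).
rewrite -mulmxA row_mul -colE.
have -> : row h (col k (K *m gram m)) = ((K *m gram m) h k)%:M.
  by apply/matrixP=> a b; rewrite !ord1 !mxE.
rewrite mul_scalar_mx -/(cvec F L T m s0); apply: contraTeq => nz.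
by rewrite (eqmx_scale _ nz).
Qed.

End SimpleFactor.

(** * Nilpotency from vanishing on linked simple modules *)

Lemma key_nil i l w : w * e i = e i * w ->
  (forall m, in_LambdaP L T (Ti i) l -> in_LambdaP L T (Ti i) m ->
     cell_linked F A L le T c r (in_eAe F A I e i) (Ti i) l m ->
     crho m w *m gram m = 0) ->
  exists N, crho l (e i) *m crho l (w ^+ N) = 0.
Proof.
move=> we linked0; set S := in_eAe F A I e i.
have s0 : is_submod F A L T r S l 0 by move=> a _; rewrite mul0mx sub0mx.
have [k [M [M0 Mk sM ltM simM]]] :=
  exists_comp_chain S l _ _ s0 (Dmod_submod i l) (sub0mx _ _).
have Mle d : (d <= k)%N -> (M (k - d)%N <= M k)%MS.
  elim: d => [|d IHd] dk; first by rewrite subn0.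
  rewrite (submx_trans _ (IHd (ltnW dk))) //.
  by rewrite -[in M (k - d)%N](subnSK dk) ltmxW // ltM // ltn_subrL (leq_trans _ dk).
have MD j : (j <= k)%N -> (M j <= Dmod F L T (Ti i) l)%MS.
  move=> jk; case/andP: Mk => MkD _; apply: submx_trans MkD.
  by rewrite -(subKn jk) Mle // leq_subr.
(* The factor is the simple module of some [m] linked to [l], where [w] acts as zero; thus [w] moves
   the series one step down. *)
have step j : (j < k)%N -> (M j.+1 *m crho l w <= M j)%MS.
  move=> jk; have [m [L0m LPm iso]] := simple_factor i l _ _ (sM j) (sM j.+1)
    (ltM j jk) (MD _ jk) (fun U => simM j U jk).
  have LPl : in_LambdaP L T (Ti i) l.
    apply: contraT => /existsPn noT; have := MD _ jk.
    rewrite /Dmod big_pred0 => [M0'|s]; last exact: (negPf (noT s)).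
    have := ltM _ jk; rewrite ltmxE => /andP[_ /negP]; case.
    exact: submx_trans M0' (sub0mx _ _).
  have wG : crho m w *m gram m = 0.
    apply: linked0 => //; split=> //; exists k, M, j; split=> //; split=> //.
    by rewrite M0 submx_refl.
  have /eqP ME : M j.+1 *m crho l (e i) == M j.+1 by rewrite -sub_Dmod_e MD.
  (* [w] need not lie in the corner algebra, but it acts on the series as [w * e i], which does. *)
  have Swe : S (w * e i) by apply/eAeP; rewrite -mulrA ee mulrA -we -mulrA ee.
  have [f [_ /andP[_ N2f] /andP[_ RK] hom]] := iso.
  rewrite -ME -mulmxA -crhoM (submx_trans (submxMr _ N2f)) // addsmxMr addsmx_sub.
  rewrite sM // andbT -mulmxA -[f *m _](subKr (crho m (w * e i) *m f)) mulmxBr.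
  rewrite addmx_sub ?eqmx_opp ?hom // mulmxA.
  set D := Dmod F L T (Ti i) m.
  have DR : (D *m crho m (w * e i)%R <= Radm F A L le T c (Ti i) m)%MS.
    rewrite sub_Radm_e -sub_Dmod_e Dmod_submod //=.
    by rewrite crhoM -!mulmxA wG !mulmx0.
  rewrite (submx_trans (submxMr f DR)) // submxE -mulmxA.
  exact/eqP/sub_kermxP/(submx_trans RK (capmxSr _ _)).
have nilM j : (j <= k)%N -> M j *m crho l (w ^+ j) = 0.
  elim: j => [|j IHj] jk; first by rewrite M0 mul0mx.
  rewrite exprSr crhoM mulmxA; apply/eqP; rewrite -submx0 -(IHj (ltnW jk)).
  exact: submxMr (step j jk).
exists k; apply/eqP; rewrite -submx0 -(nilM k) // submxMr // -crho_ee.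
case/andP: Mk => _; apply: submx_trans; rewrite sub_Dmod_e -mulmxA.
by rewrite !crho_ee.
Qed.

Definition linked_e (x y : L) : Prop := exists i,
  [/\ in_LambdaP L T (Ti i) x, in_LambdaP L T (Ti i) y &
      cell_linked F A L le T c r (in_eAe F A I e i) (Ti i) x y].

Lemma crhoX_leq l w m n : (m <= n)%N -> crho l (w ^+ m) = 0 -> crho l (w ^+ n) = 0.
Proof. by move=> mn w0; rewrite -(subnK mn) exprD crhoM w0 mul0mx. Qed.

Lemma crho_nil l w : (forall i, w * e i = e i * w) ->
  (forall m, linked_e l m -> crho m w *m gram m = 0) ->
  exists N, crho l (w ^+ N) = 0.
Proof.
move=> we linked0.
have /fin_all_exists[N N0] i : exists N, crho l (e i) *m crho l (w ^+ N) = 0.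
  by apply: key_nil => // m Ll Lm lm; apply: linked0; exists i.
exists (\max_i N i); rewrite -[crho l _]mul1mx -crho1 -sum_e crho_sum mulmx_suml.
apply: big1 => i _; rewrite -(subnK (leq_bigmax i)) exprD crhoM mulmxA N0.
by rewrite mul0mx.
Qed.

(** After [n] applications all coordinates at cells of height at most [n] have vanished. *)
Lemma raising_nilpotent (E : A -> A) y : linear E ->
  (forall m s t, E (c m s t) \in Agt all_idx m) -> iter #|L| E y = 0.
Proof.
move=> lE raiseE.
suff vanish n m s t : (height m <= n)%N -> coef m s t (iter n E y) = 0.
  by apply: coefP => m s t; rewrite coef0 vanish // height_max.
elim: n m s t => [|n IHn] m s t hm; first by rewrite leqNgt height_gt0 in hm.
rewrite iterS (lin_expand _ _ _ lE).
rewrite coef_sum big1 // => k _; rewrite coef_sum big1 // => u _.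
rewrite coef_sum big1 // => v _; rewrite coefZ.
have [km|km] := boolP (lt k m).
  by rewrite IHn ?mul0r // -ltnS (leq_trans (height_lt _ _ km)).
by have /AgtP-> := raiseE k u v; rewrite ?mulr0 // (negPf km).
Qed.

(** * Elements killing cell modules, and elements with prescribed scalars *)

Lemma crho0_mul z m s t : crho m z = 0 -> z * c m s t \in Agt all_idx m.
Proof.
move=> z0; have := mul_c z m s t; rewrite big1 ?subr0 // => u _.
have /matrixP/(_ (enum_rank s) (enum_rank u)) := z0.
by rewrite !mxE !enum_rankK => ->; rewrite scale0r.
Qed.

Lemma mul_crho0 z m s t : crho m (star z) = 0 -> c m s t * z \in Agt all_idx m.
Proof.
move=> z0; rewrite -[c _ _ _ * z]starK starM star_c.
by apply: Agt_star; apply: crho0_mul.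
Qed.

(** Left multiplication by [z] raises the cell filtration, yet it fixes [z]. *)
Lemma crho_idem0 z : z * z = z -> (forall m, crho m z = 0) -> z = 0.
Proof.
move=> zz z0; have <- : iter #|L| ( *%R z) z = z.
  by elim: #|L| => //= n ->.
apply: raising_nilpotent; first exact: linear_mull.
by move=> m s t; apply: crho0_mul.
Qed.

(* Acts as the identity on [L(m)] and as zero on [Delta(l)] unless [m <= l]. *)
Definition cell_unit (m : L) : A :=
  \sum_i \sum_j pinvmx (gram m) i j *: c m (enum_val j) (enum_val i).

(** The element acts on its own cell as [gram m *m pinvmx (gram m)], and a pseudo-inverse $X$ of $G$
    satisfies $GXG=G$. *)
Lemma crho_cell_unit m : crho m (cell_unit m) *m gram m = gram m.
Proof.
rewrite -[RHS](mulmxKpV (submx_refl _)); congr (_ *m _).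
rewrite crho_sum [pinvmx _ in RHS]matrix_sum_delta mulmx_sumr.
apply: eq_bigr => i _; rewrite crho_sum mulmx_sumr; apply: eq_bigr => j _.
by rewrite crhoZ crho_c !enum_valK -scalemxAr.
Qed.

Lemma crho_cell_unit_le l m : ~~ le m l -> crho l (cell_unit m) = 0.
Proof.
move=> ml; rewrite crho_sum big1 // => i _; rewrite crho_sum big1 // => j _.
by rewrite crhoZ crho_c_le ?scaler0.
Qed.

Lemma lift_scalars (b : L -> F) :
  exists a, forall l, crho l a *m gram l = b l *: gram l.
Proof.
suff [a aP] : exists a, forall l, (height l <= #|L|)%N ->
    crho l a *m gram l = b l *: gram l.
  by exists a => l; apply/aP/height_max.
(* Induction on the height: [cell_unit m] does not disturb the cells already treated. *)
elim: #|L| => [|n [a aP]].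
  by exists 0 => l; rewrite leqNgt height_gt0.
(* At each cell of height [n.+1] the correction replaces the action of [a] by the scalar [b m]. *)
exists (a + \sum_(m | height m == n.+1) cell_unit m * ((b m)%:A - a)) => l hl.
rewrite crhoD crho_sum mulmxDl mulmx_suml.
have zero m : height m = n.+1 -> m != l ->
    crho l (cell_unit m * ((b m)%:A - a)) *m gram l = 0.
  move=> hm ml; rewrite crhoM crho_cell_unit_le ?mulmx0 ?mul0mx //.
  apply/negP=> lem; have := height_lt m l; rewrite /lt_cell lem ml hm.
  by move/(_ isT)/leq_trans/(_ hl); rewrite ltnn.
have [hln|hln] := eqVneq (height l) n.+1.
  rewrite (bigD1 l) ?hln //= big1 ?addr0 => [|m /andP[/eqP hm ml]]; last exact: zero.
  rewrite crhoM -mulmxA crho_cell_unit crhoB crhoZ crho1 mulmxBl addrC subrK.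
  by rewrite -scalemxAl mul1mx.
rewrite big1 ?addr0 => [|m /eqP hm]; last first.
  by apply: zero => //; apply: contraNneq hln => <-; apply/eqP.
by apply: aP; rewrite -ltnS ltn_neqAle hln.
Qed.

(** Cutting [a] down to its diagonal corners makes it commute with every [e j]. The scalars survive
    because each [e i] is self-adjoint for the form. *)
Lemma lift_scalars_comm (b : L -> F) : exists a,
  (forall i, a * e i = e i * a) /\
  forall l, crho l a *m gram l = b l *: gram l.
Proof.
have [a aP] := lift_scalars b; exists (\sum_i e i * a * e i); split=> [j|l].
  rewrite mulr_suml mulr_sumr (bigD1 j) //= [RHS](bigD1 j) //=.
  congr (_ + _); first by rewrite -mulrA ee !mulrA ee.
  rewrite !big1 // => i ij; last by rewrite -!mulrA ee0 ?mulr0.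
  by rewrite !mulrA ee0 ?mul0r // eq_sym.
rewrite crho_sum mulmx_suml -[gram l in RHS]mul1mx -crho1 -sum_e crho_sum.
rewrite mulmx_suml scaler_sumr; apply: eq_bigr => i _.
rewrite !crhoM -!mulmxA e_gram [crho l a *m _]mulmxA aP -scalemxAl -scalemxAr.
by rewrite -e_gram mulmxA crho_ee.
Qed.

Lemma star_comm_e a : (forall i, a * e i = e i * a) ->
  forall i, star a * e i = e i * star a.
Proof. by move=> ae i; rewrite -star_e -!starM ae. Qed.

(** Transpose the identity: [star a] is adjoint to [a] and the Gram matrix is symmetric. *)
Lemma star_scalar a l k :
  crho l a *m gram l = k *: gram l -> crho l (star a) *m gram l = k *: gram l.
Proof.
move=> aG; rewrite crho_adj starK -[LHS]trmxK trmx_mul trmxK tr_gram aG.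
by rewrite linearZ /= tr_gram.
Qed.

(** * The central idempotent of a union of linkage classes *)

Section ClassIdempotent.
Variable b : L -> bool.
Hypothesis b_linked : forall x y, linked_e x y -> b x = b y.

(** Linked indices share the value of [b], so the base of the power acts as zero on every simple
    module linked to [l]. Finiteness of [L] gives a common exponent. *)
Lemma class_nil a : (forall i, a * e i = e i * a) ->
  (forall l, crho l a *m gram l = (b l)%:R *: gram l) ->
  exists N, forall n l, (N <= n)%N ->
    crho l ((if b l then 1 - a else a) ^+ n) = 0.
Proof.
move=> ae aG.
have /fin_all_exists[N N0] l : exists N, crho l ((if b l then 1 - a else a) ^+ N) = 0.
  apply: crho_nil => [i|m /b_linked ->].
    by case: (b l); rewrite // mulrBl mulrBr ae mul1r mulr1.
  case: (b m) (aG m) => aGm; last by rewrite aGm scale0r.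
  by rewrite crhoB crho1 mulmxBl mul1mx aGm scale1r subrr.
exists (\max_l N l) => n l Nn; apply: crhoX_leq (N0 l).
exact: leq_trans (leq_bigmax l) Nn.
Qed.

Lemma class_scalar a n (h := 1 - (1 - a ^+ n) ^+ n) l :
  crho l ((if b l then 1 - a else a) ^+ n) = 0 -> crho l h = (b l)%:R%:M.
Proof.
have [q1 [q2 [hE _ h1E]]] := idem_poly A a n; rewrite -/h in hE h1E.
case: (b l) => an0; last by rewrite hE crhoM an0 mulmx0 scalar_mx0.
have: crho l (1 - h) = 0 by rewrite h1E crhoM an0 mulmx0.
by rewrite crhoB crho1 => /subr0_eq <-.
Qed.

Lemma class_idempotent : exists g : A,
  [/\ central F A g, g * g = g & forall l, crho l g = (b l)%:R%:M].
Proof.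
have [a [ae aG]] := lift_scalars_comm (fun l => (b l)%:R).
have [N1 aN] := class_nil a ae aG.
have [N2 asN] := class_nil (star a) (star_comm_e a ae)
  (fun l => star_scalar a l _ (aG l)).
(* On each cell module one of the two factors of [x] is zero, so left multiplication by [x] raises
   the filtration and [x] is nilpotent. *)
pose N := maxn N1 N2; pose x := a ^+ N * (1 - a) ^+ N.
have x0 m : crho m x = 0.
  have := aN N m (leq_maxl _ _); rewrite crhoM.
  by case: (b m) => ->; rewrite ?mul0mx ?mulmx0.
have xL : x ^+ #|L| = 0.
  have -> : x ^+ #|L| = iter #|L| ( *%R x) 1.
    by elim: #|L| => [|k IHk] /=; rewrite ?expr0 // exprS IHk.
  by apply: raising_nilpotent => [|m s t]; [apply: linear_mull | apply: crho0_mul].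
(* With this exponent [a ^+ n * (1 - a) ^+ n] is [x ^+ #|L|.+1], hence zero, which makes [h]
   idempotent. *)
pose n := (N * #|L|.+1)%N; have Nn : (N <= n)%N by rewrite leq_pmulr.
pose h := 1 - (1 - a ^+ n) ^+ n.
have comm_a1 : GRing.comm a (1 - a).
  by apply: commrB; [apply: commr1 | apply: commr_refl].
have an0 : a ^+ n * (1 - a) ^+ n = 0.
  rewrite !exprM -exprMn_comm; first by rewrite -/x exprS xL mulr0.
  by apply: commrX; apply: commr_sym; apply: commrX; apply: commr_sym.
have hh : h * (1 - h) = 0.
  have [q1 [q2 [_ hE h1E]]] := idem_poly A a n; rewrite -/h in hE h1E.
  by rewrite h1E hE -mulrA (mulrA (a ^+ n)) an0 mul0r mulr0.
have hS l : crho l h = (b l)%:R%:M.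
  by apply/class_scalar/aN/(leq_trans (leq_maxl _ _) Nn).
(* [star h] is the same polynomial in [star a], which has the same scalars as [a]. *)
have shS l : crho l (star h) = (b l)%:R%:M.
  rewrite /h starB star1 starX starB star1 starX.
  by apply/class_scalar/asN/(leq_trans (leq_maxr _ _) Nn).
clearbody h.
have hidem : h * h = h by apply/esym/subr0_eq; rewrite -{1}[h]mulr1 -mulrBr.
(* The map [E] fixes [u * y * v] and raises the filtration, since at each cell either [u] acts as
   zero from the left or [v] from the right. *)
have sandwich0 u v y : u * u = u -> v * v = v ->
    (forall m, crho m u = 0 \/ crho m (star v) = 0) -> u * y * v = 0.
  move=> uu vv uv; pose E z := u * z * v.
  have <- : iter #|L| E (u * y * v) = u * y * v.
    by elim: #|L| => //= k ->; rewrite /E !mulrA uu -!mulrA vv.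
  apply: raising_nilpotent => [k z1 z2|m s t].
    by rewrite /E mulrDr mulrDl -scalerAr -scalerAl.
  case: (uv m) => [u0|v0]; first by apply/Agt_mulr/crho0_mul.
  by rewrite /E -mulrA; apply/Agt_mull/mul_crho0.
have h1idem : (1 - h) * (1 - h) = 1 - h by rewrite {1}mulrBl hh subr0 mul1r.
have hxh1 y : h * y * (1 - h) = 0.
  apply: sandwich0 => // m; rewrite starB star1 crhoB crho1 hS shS.
  by case: (b m); [right; rewrite subrr | left; rewrite scalar_mx0].
have h1xh y : (1 - h) * y * h = 0.
  apply: sandwich0 => // m; rewrite crhoB crho1 hS shS.
  by case: (b m); [left; rewrite subrr | right; rewrite scalar_mx0].
exists h; split=> // y.
(* Both [h * y] and [y * h] equal [h * y * h]. *)
have /eqP := hxh1 y; rewrite mulrBr mulr1 subr_eq0 => /eqP->.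
by have /eqP := h1xh y; rewrite mulrBl mulrBl mul1r subr_eq0 => /eqP->.
Qed.

End ClassIdempotent.

(** * Blocks as linkage classes *)

Hypothesis allL0 : forall l, in_Lambda0 F A L le T c all_idx l.

Lemma gram_neq0 l : gram l != 0.
Proof. by have := allL0 l; rewrite /in_Lambda0 Gram_all. Qed.

(** [z] commutes with the operators $v\mapsto\langle v,c_j\rangle c_u$. Comparing entries in row
    [i], where the Gram entry at [(i, j)] is nonzero, determines every entry of the action. *)
Lemma central_scalar z l : central F A z -> exists k, crho l z = k%:M.
Proof.
move=> cz; have /matrix0Pn[i [j Gij]] := gram_neq0 l.
pose k := (crho l z *m gram l) i j / gram l i j; exists k; apply/matrixP=> u v.
have := crhoM l z (c l (enum_val u) (enum_val j)).
rewrite -cz crhoM crho_c !enum_valK mulmxA => /matrixP/(_ i v).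
rewrite mulmx_delta mulmx_delta_mulmx => zuv.
apply: (mulfI Gij); rewrite -zuv [k%:M _ _]mxE eq_sym.
by case: (u == v); [rewrite mulr1 mulr1n mulrC divfK | rewrite mulr0n !mulr0].
Qed.

Lemma scalar_cell_eq0 l (k : F) : (k%:M == 0 :> 'M[F]_(csize L T l)) = (k == 0).
Proof.
apply/eqP/eqP => [k0|->]; last exact: scalar_mx0.
apply/eqP; have : k *: gram l == 0 by rewrite -mul_scalar_mx k0 mul0mx.
by rewrite scaler_eq0 (negPf (gram_neq0 l)) orbF.
Qed.

Lemma scalar_acts z l k : crho l z = k%:M ->
  acts_nonzero F A L le T c r z l = (k != 0).
Proof.
move=> zk; rewrite acts_nonzeroE zk mul_scalar_mx scaler_eq0.
by rewrite (negPf (gram_neq0 l)) orbF.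
Qed.

(** The map [f] intertwines the two scalars of [z * e i] modulo [M j]. If they differed, [f] would
    vanish modulo [M j], and the radical would be the whole truncated cell module. *)
Lemma linked_acts z x y : central F A z -> linked_e x y ->
  acts_nonzero F A L le T c r z x = acts_nonzero F A L le T c r z y.
Proof.
move=> cz [i [_ _ [L0y [k [M [j [_ _ [f [_ _ /andP[KR _] hom]]]]]]]]].
have [kx zx] := central_scalar z x cz; have [ky zy] := central_scalar z y cz.
rewrite (scalar_acts _ _ _ zx) (scalar_acts _ _ _ zy).
have [-> //|kxy] := eqVneq kx ky.
set D := Dmod F L T (Ti i) y in hom KR.
have Se : in_eAe F A I e i (e i) by apply/eAeP; rewrite ee.
have Sze : in_eAe F A I e i (z * e i) by apply/eAeP; rewrite mulrA cz -mulrA ee.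
have DfN : (D *m f <= M j)%MS.
  have /eqP DE : D *m crho y (e i) == D by rewrite -sub_Dmod_e.
  have := hom _ Sze; have := hom _ Se; rewrite !crhoM zx zy !mul_mx_scalar.
  rewrite -scalemxAl -scalemxAr !mulmxBr -!scalemxAr.
  rewrite [D *m (crho y (e i) *m f)]mulmxA DE => H1 H2.
  have H3 := addmx_sub H2 (scalemx_sub (- kx) H1).
  rewrite scalerBr !scaleNr opprK addrACA addNr addr0 -scalerBl in H3.
  by rewrite eqmx_scale // subr_eq0 eq_sym in H3.
case/negP: L0y; rewrite Gram_e.
have DK : (D <= D :&: kermx (f *m cokermx (M j)))%MS.
  rewrite sub_capmx submx_refl; apply/sub_kermxP/eqP.
  by rewrite mulmxA -submxE.
have := submx_trans DK KR; rewrite sub_Radm_e => /andP[_ /eqP DG].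
have /submxP[w ->] : (crho y (e i) <= D)%MS by rewrite sub_Dmod_e crho_ee.
by rewrite -mulmxA DG mulmx0.
Qed.

Definition cell_support (z : A) : {set L} := [set m | crho m z != 0].

(** The support of [z2] is nonempty, lies in that of [z], and misses that of [z1] because the
    scalars of [z1] and [z2] multiply to zero. *)
Lemma support_split z z1 z2 : central_idem F A z1 -> central_idem F A z2 ->
  z1 * z2 = 0 -> z = z1 + z2 ->
  (#|cell_support z1| < #|cell_support z|)%N.
Proof.
move=> [c1 i1 n1] [c2 i2 n2] z12 zE.
have sup1 m : crho m z != 0 \/ crho m z1 = 0 /\ crho m z2 = 0.
  have [z0|] := eqVneq (crho m z) 0; [right | by left].
  have -> : z1 = z1 * z by rewrite zE mulrDr i1 z12 addr0.
  have -> : z2 = z2 * z by rewrite zE mulrDr i2 c1 z12 add0r.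
  by rewrite !crhoM z0 !mul0mx.
apply/proper_card/properP; split.
  apply/subsetP=> m; rewrite !inE => nz.
  by case: (sup1 m) => // -[z0]; rewrite z0 eqxx in nz.
have [m zm] : exists m, crho m z2 != 0.
  apply/existsP; apply: contraT; rewrite negb_exists => /forallP z0.
  by case/eqP: n2; apply: crho_idem0 => // m; apply/eqP; rewrite -[_ == _]negbK z0.
exists m; rewrite inE ?negbK.
  by case: (sup1 m) => // -[_ z0]; rewrite z0 eqxx in zm.
have [k1 E1] := central_scalar z1 m c1; have [k2 E2] := central_scalar z2 m c2.
have := crhoM m z1 z2; rewrite z12 E1 E2 -scalar_mxM -(scale0r 0) crhoZ scale0r.
move=> /esym/eqP; rewrite E2 in zm; rewrite !scalar_cell_eq0 mulf_eq0 in zm *.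
by rewrite (negPf zm).
Qed.

(** Descent on the size of the support: when [z] splits, one of the summands still acts nontrivially
    at [l]. *)
Lemma exists_primitive z l : central_idem F A z ->
  acts_nonzero F A L le T c r z l -> exists z',
  primitive_central_idem F A z' /\ acts_nonzero F A L le T c r z' l.
Proof.
have [n] := ubnP #|cell_support z|.
elim: n z => // n IHn z zn cz zl.
have [|prim] := excluded_middle_informative (exists z1 z2,
  [/\ central_idem F A z1, central_idem F A z2, z1 * z2 = 0 & z = z1 + z2]).
  move=> [z1 [z2 [c1 c2 z12 zE]]].
  have [a1|a1] := boolP (acts_nonzero F A L le T c r z1 l).
    apply: (IHn z1) => //; apply: leq_trans (ltnSE zn).
    exact: support_split c1 c2 z12 zE.
  apply: (IHn z2) => //.
    apply: leq_trans (ltnSE zn); rewrite addrC in zE.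
    by apply: (support_split _ _ _ c2 c1 _ zE); case: c1 => ->.
  move: zl a1; rewrite !acts_nonzeroE zE crhoD mulmxDl negbK => + /eqP z10.
  by rewrite z10 add0r.
by exists z.
Qed.

Lemma linked_class_acts z x y : central F A z ->
  clos_refl_sym_trans L linked_e x y ->
  acts_nonzero F A L le T c r z x = acts_nonzero F A L le T c r z y.
Proof.
move=> cz; elim=> {x y} [x y lxy|//|x y _ -> //|x y w _ -> _ -> //].
exact: linked_acts lxy.
Qed.

Lemma central_idemM u v : central F A u -> u * u = u ->
  central F A v -> v * v = v -> central F A (u * v) /\ u * v * (u * v) = u * v.
Proof.
move=> cu uu cv vv; split=> [a|]; first by rewrite mulrA cu -mulrA cv mulrA.
by rewrite -mulrA (mulrA v) cu -(mulrA u v v) vv mulrA uu.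
Qed.

Lemma same_blockP l m : same_block F A L le T c r l m <->
  clos_refl_sym_trans L linked_e l m.
Proof.
split=> [[z [[cz prim] zl zm]]|lm]; last first.
  have [z [pz zl]] : exists z, primitive_central_idem F A z /\
      acts_nonzero F A L le T c r z l.
    apply: (exists_primitive 1); first split.
    - by move=> a; rewrite mulr1 mul1r.
    - by rewrite mulr1.
    - exact: oner_neq0.
    - by rewrite (scalar_acts _ _ 1) ?crho1 ?oner_neq0.
  exists z; split=> //; rewrite -(linked_class_acts _ _ _ _ lm) //.
  by case: pz => -[].
have [//|nlm] := excluded_middle_informative (clos_refl_sym_trans L linked_e l m).
(* The indicator of the linkage class of [l], which does not contain [m]. *)
pose b x : bool := excluded_middle_informative (clos_refl_sym_trans L linked_e l x).
have b_linked x y : linked_e x y -> b x = b y.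
  move=> xy; rewrite /b.
  case: excluded_middle_informative => lx; case: excluded_middle_informative => ly //=.
    by case: ly; apply: rst_trans lx _; apply: rst_step.
  by case: lx; apply: rst_trans ly _; apply/rst_sym/rst_step.
have [g [cg gg gS]] := class_idempotent b b_linked.
have bl : b l.
  by rewrite /b; case: excluded_middle_informative => // -[]; apply: rst_refl.
have bm : b m = false by rewrite /b; case: excluded_middle_informative.
have [ccz zz _] := cz.
have crho0 x : crho x 0 = 0 by rewrite -(scale0r 0) crhoZ scale0r.
(* [g] acts as 1 at [l] and as 0 at [m], so both summands are nonzero and [z] is not primitive. *)
case: prim; exists (z * g), (z * (1 - g)).
have cg1 : central F A (1 - g).
  by move=> a; rewrite mulrBr mulrBl mulr1 mul1r cg.
have gg1 : (1 - g) * (1 - g) = 1 - g.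
  by rewrite mulrBl mul1r mulrBr mulr1 gg subrr subr0.
have [czg zgg] := central_idemM _ _ ccz zz cg gg.
have [czg1 zgg1] := central_idemM _ _ ccz zz cg1 gg1.
split.
- split=> //; apply: contraTneq zl => zg0; rewrite acts_nonzeroE negbK.
  have := crhoM l z g; rewrite zg0 crho0 gS bl mul1mx => <-.
  by rewrite mul0mx.
- split=> //; apply: contraTneq zm => zg0; rewrite acts_nonzeroE negbK.
  have := crhoM m z (1 - g); rewrite zg0 crho0 crhoB crho1 gS bm scalar_mx0.
  by rewrite subr0 mul1mx => <-; rewrite mul0mx.
- by rewrite -mulrA (mulrA g) ccz -(mulrA z g) mulrBr mulr1 gg subrr !mulr0.
- by rewrite -mulrDr addrC subrK mulr1.
Qed.

(** * Linkage classes as chains of cell-blocks *)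

Lemma linked_chain l m : clos_refl_sym_trans L linked_e l m ->
  exists (k : nat) (nu : nat -> L), [/\ nu 0%N = l, nu k = m &
    forall j, (j < k)%N ->
      exists i, same_cellblock_e F A L le T c r I e i (nu j) (nu j.+1)].
Proof.
elim=> {l m} [x y [i [Lx Ly lxy]]|x|x y _ [k [nu [n0 nk step]]]
    |x y z _ [k [nu [n0 nk step]]] _ [k' [nu' [n0' nk' step']]]].
- exists 1%N, (fun j => if j is 0%N then x else y); split=> // -[] // _; exists i.
  by split=> //; apply: rst_step.
- by exists 0%N, (fun=> x).
- exists k, (fun j => nu (k - j)%N); split=> [||j jk]; rewrite ?subn0 ?subnn //.
  have [|i [L1 L2 L12]] := step (k - j.+1)%N.
    by rewrite ltn_subrL (leq_trans _ jk).
  by rewrite subnSK // in L2 L12; exists i; split=> //; apply: rst_sym.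
(* The chains meet at [nu k = nu' 0]; position [k] is read from [nu']. *)
exists (k + k')%N, (fun j => if (j < k)%N then nu j else nu' (j - k)%N); split.
- by case: k n0 nk step => [|k] //= n0 nk _; rewrite n0' -nk n0.
- by rewrite ltnNge leq_addr /= addKn.
move=> j jk; case: ltnP => [jk1|kj].
  have [i sc] := step j jk1; exists i; case: ltnP => // kj1.
  have jE : j.+1 = k by apply/eqP; rewrite eqn_leq jk1.
  by rewrite jE subnn n0' -nk -jE.
rewrite ltnNge (leq_trans kj) //= subSn //; apply: step'.
by rewrite ltn_subLR.
Qed.

(** [T l] is nonempty and each of its elements is fixed by some [e i], so [l] belongs to the poset
    of some corner algebra. *)
Lemma cellblock_refl l : exists i, same_cellblock_e F A L le T c r I e i l l.
Proof.
have [t _] := T_inh l; have [i Tt] := Tidx_ex l t.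
by exists i; split; [apply/existsP; exists t.. | apply: rst_refl].
Qed.

Lemma cellblock_linked i l m : same_cellblock_e F A L le T c r I e i l m ->
  clos_refl_sym_trans L linked_e l m.
Proof.
case=> _ _; elim=> {l m} [x y lxy|x|x y _|x y z _ + _].
- by apply: rst_step; exists i.
- exact: rst_refl.
- exact: rst_sym.
- exact: rst_trans.
Qed.

End CellularTheory.

Theorem theorem5p1 (F : fieldType) (A : falgType F)
  (L : finType) (le : rel L) (T : L -> finType)
  (c : forall l : L, T l -> T l -> A) (star : A -> A)
  (r : forall l : L, A -> T l -> T l -> F)
  (I : finType) (e : I -> A) :
  is_cellular F A L le T c star r ->
  idem_decomp F A L T c star I e ->
  (forall l : L, in_Lambda0 F A L le T c (allidx L T) l) ->
  forall l m : L,
    same_block F A L le T c r l m <->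
    exists (k : nat) (nu : nat -> L),
      [/\ exists i : I, same_cellblock_e F A L le T c r I e i l (nu 0%N),
          (forall j : nat, (j < k)%N ->
             exists i : I, same_cellblock_e F A L le T c r I e i (nu j) (nu j.+1)) &
          exists i : I, same_cellblock_e F A L le T c r I e i m (nu k)].
Proof.
move=> cellA idemE allL0 l m.
rewrite (same_blockP F A L le T c star r cellA I e idemE allL0).
split=> [/(linked_chain F A L le T c r I e)[k [nu [<- <- step]]]|].
  (* The chain already runs from [l] to [m], so both end conditions hold by reflexivity. *)
  have refl := cellblock_refl F A L le T c star r cellA I e idemE.
  by exists k, nu; split.
move=> [k [nu [[i0 l0] step [ik mk]]]].
have linkE := cellblock_linked F A L le T c r I e.
apply: rst_trans (linkE _ _ _ l0) _; apply: rst_sym.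
apply: rst_trans (linkE _ _ _ mk) _; apply: rst_sym; move: step {mk}.
elim: k => [|k IHk] step; first exact: rst_refl.
have [i nk] := step k (ltnSn k); apply: rst_trans (linkE _ _ _ nk).
by apply: IHk => j jk; apply/step/(leq_trans jk).
Qed.
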